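(* Consider a $\sqrt{n}\times\sqrt{n}$ torus grid of $n$ servers and a library of $K=n$ files with the Uniform popularity distribution $p_j=1/K$. Each server independently caches $M=n^{\alpha}$ files, for some constant $0<\alpha<1/2$, drawn independently from the popularity distribution with replacement. Then $n$ requests arrive sequentially; each request's origin server is chosen uniformly at random among the $n$ servers and its requested file is drawn from the popularity distribution. Under the Nearest Replica Strategy (Strategy I), with high probability the maximum load $L$ satisfies $L=\Omega(\log n/\log\log n)$ and $L=O(\log n)$.
   Context: Strategy I (Nearest Replica Strategy): each request is assigned to the nearest server, in graph shortest-path distance on the torus, that has cached the requested file; ties are broken randomly. Letting $T_i$ be the number of requests assigned to server $i$ after all $n$ requests are assigned, the maximum load is $L=\max_{1\le i\le n}T_i$. ''With high probability'' means with probability $1-1/n^c$ for some constant $c>0$. *)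

(* Defs.v *)
From HB Require Import structures.
From mathcomp Require Import all_boot all_order all_algebra.
From mathcomp Require Import all_classical all_reals all_analysis.
Set Implicit Arguments.
Unset Strict Implicit.
Unset Printing Implicit Defensive.
Import Order.TTheory GRing.Theory Num.Theory.
Local Open Scope ring_scope.

(* Least length of an e-path from x to y. Since nth 0 (iota 0 n) k = k, [find]
   returns the length itself; it returns #|T| when y is unreachable from x, and
   a shortest path never has #|T| or more edges. *)
Definition graph_dist (T : finType) (e : rel T) (x y : T) : nat :=
  find (fun k => [exists p : k.-tuple T, path e x p && (last x p == y)])
    (iota 0 #|T|).

Definition server (m : nat) : finType := ('I_m * 'I_m)%type.

Definition cycle_adj (m : nat) : rel 'I_m :=
  fun i j => (j == ordS i) || (i == ordS j).

Definition torus_adj (m : nat) : rel (server m) :=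
  fun u v => ((u.1 == v.1) && cycle_adj u.2 v.2)
          || (cycle_adj u.1 v.1 && (u.2 == v.2)).

(* m : side of the torus; K : number of files; M : cache slots per server;
   N : number of requests. *)

Definition placement (m K M : nat) : finType :=
  {ffun server m -> {ffun 'I_M -> 'I_K}}.

(* Origin and requested file of each request, in order of arrival. *)
Definition requests (m K N : nat) : finType :=
  {ffun 'I_N -> server m * 'I_K}.

(* Server each request is assigned to; [None] when no server caches the
   requested file. *)
Definition assignment (m N : nat) : finType :=
  {ffun 'I_N -> option (server m)}.

Definition outcome (m K M N : nat) : finType :=
  (placement m K M * requests m K N * assignment m N)%type.

Definition replicas (m K M : nat) (Z : placement m K M) (f : 'I_K) :
    {set server m} :=
  [set v | [exists s, Z v s == f]].

Definition nearest_replicas (m K M : nat) (Z : placement m K M)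
    (u : server m) (f : 'I_K) : {set server m} :=
  [set v in replicas Z f | [forall w in replicas Z f,
     (graph_dist (@torus_adj m) u v <= graph_dist (@torus_adj m) u w)%N]].

Definition load (m N : nat) (A : assignment m N) (v : server m) : nat :=
  #|[set i | A i == Some v]|.

Definition max_load (m N : nat) (A : assignment m N) : nat :=
  (\max_(v : server m) load A v)%N.

Section Probability.
Variable R : realType.

Definition uniform_popularity (K : nat) : 'I_K -> R := fun _ => K%:R^-1.

Definition placement_mass (m K M : nat) (p : 'I_K -> R)
    (Z : placement m K M) : R :=
  \prod_(v : server m) \prod_(s < M) p (Z v s).

Definition requests_mass (m K N : nat) (p : 'I_K -> R)
    (Q : requests m K N) : R :=
  \prod_(i < N) (#|server m|%:R^-1 * p (Q i).2).

(* Uniform choice of an element of S, for breaking ties; [None] if S is empty. *)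
Definition tie_mass (T : finType) (S : {set T}) (o : option T) : R :=
  if o is Some v then (v \in S)%:R / #|S|%:R else (S == finset.set0)%:R.

(* Conditional mass, given Z and Q, of the assignment made by the nearest
   replica strategy. *)
Definition nearest_mass (m K M N : nat) (Z : placement m K M)
    (Q : requests m K N) (A : assignment m N) : R :=
  \prod_(i < N) tie_mass (nearest_replicas Z (Q i).1 (Q i).2) (A i).

Definition outcome_mass (m K M N : nat) (p : 'I_K -> R)
    (w : outcome m K M N) : R :=
  let: (Z, Q, A) := w in
  placement_mass p Z * requests_mass p Q * nearest_mass Z Q A.

Definition Pr (m K M N : nat) (p : 'I_K -> R) (E : pred (outcome m K M N)) : R :=
  \sum_(w | E w) outcome_mass p w.

Lemma tie_mass_total (T : finType) (S : {set T}) :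
  \sum_(o : option T) tie_mass S o = 1.
Proof.
rewrite (bigD1 None) //= (reindex_omap Some id) /=; last by case.
rewrite (eq_bigl predT) => [|x]; last by rewrite /= eqxx.
rewrite -mulr_suml -natr_sum -big_mkcond /= sum1_card.
have [->|S0] := eqVneq S finset.set0; first by rewrite cards0 mul0r addr0.
by rewrite add0r divff // pnatr_eq0 cards_eq0.
Qed.

Lemma Pr_total (m K M N : nat) (p : 'I_K -> R) :
  (0 < m)%N -> \sum_(f < K) p f = 1 ->
  Pr p (xpredT : pred (outcome m K M N)) = 1.
Proof.
move=> m0 p1; rewrite /Pr.
rewrite (eq_bigr (fun w : outcome m K M N =>
  (placement_mass p w.1.1 * requests_mass p w.1.2) *
  nearest_mass w.1.1 w.1.2 w.2)); last by case=> -[].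
rewrite -(pair_bigA _ (fun (x : placement m K M * requests m K N) y =>
  (placement_mass p x.1 * requests_mass p x.2) * nearest_mass x.1 x.2 y)) /=.
under eq_bigr => x _.
  rewrite -mulr_sumr -(bigA_distr_bigA (fun i o =>
    tie_mass (nearest_replicas x.1 (x.2 i).1 (x.2 i).2) o)) /=.
  under eq_bigr do rewrite tie_mass_total.
  rewrite big1 // mulr1.
  over.
rewrite -(pair_bigA _ (fun (Z : placement m K M) (Q : requests m K N) =>
  placement_mass p Z * requests_mass p Q)) /= -big_distrlr /=.
rewrite -(bigA_distr_bigA (fun _ (q : server m * 'I_K) =>
  #|server m|%:R^-1 * p q.2)) /=.
rewrite -(bigA_distr_bigA (fun _ (c : {ffun 'I_M -> 'I_K}) =>
  \prod_(s < M) p (c s))) /=.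
rewrite [X in X * _]big1 => [|v _]; last first.
  by rewrite -(bigA_distr_bigA (fun _ => p)) big1.
rewrite big1 ?mulr1 // => i _.
rewrite -(pair_bigA _ (fun (_ : server m) f => #|server m|%:R^-1 * p f)) /=.
rewrite -mulr_sumr p1 mulr1 sumr_const -[LHS]mulr_natr mulVf //.
by rewrite pnatr_eq0 card_prod card_ord muln_eq0 orbb -lt0n.
Qed.

End Probability.

(* Main.v *)
Require Import Defs.
From HB Require Import structures.
From mathcomp Require Import all_boot all_order all_algebra.
From mathcomp Require Import all_classical all_reals all_analysis.
From mathcomp Require Import ring lra zify.
Set Implicit Arguments.
Unset Strict Implicit.
Unset Printing Implicit Defensive.
Import Order.TTheory GRing.Theory Num.Theory.
Local Open Scope ring_scope.

(** Given the placement, the requests are assigned independently, with a common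
    law on the servers. A ball of order [n ln n / M] servers contains a replica
    of any given file except with polynomially small probability. So, for most
    placements, a server [v] only gets requests for the at most [M] files it
    caches from origins in a ball of that order around it, and the law gives
    [v] a mass [O(ln n / n)].

    Chernoff's bound then yields the upper bound on the load. For the lower
    bound, take [k] disjoint blocks of [g = n / (ln n)^2] requests, and count
    the ways to choose a server and one request in each block such that all the
    chosen requests go to that server. By convexity the mean of this count is at
    least [n (g / n)^k] whatever the law is, and its variance is at most [2^k]
    times its mean, so by Chebyshev's inequality it is nonzero with high
    probability when [k] is of order [ln n / ln ln n]. *)

(** * Independent balls in bins *)

Section Iid.
Variables (R : realType) (I T : finType) (q : T -> R).

Definition iid_mass (a : {ffun I -> T}) : R := \prod_i q (a i).

(** Independence in the form of distributivity; the indicator and exponential moments below are all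
    reduced to it. *)
Lemma iid_prod (h : I -> T -> R) :
  \sum_a iid_mass a * \prod_i h i (a i) = \prod_i \sum_x q x * h i x.
Proof.
rewrite (bigA_distr_bigA (fun i x => q x * h i x)).
by apply: eq_bigr => a _; rewrite big_split.
Qed.

Hypotheses (q_ge0 : forall x, 0 <= q x) (q_total : \sum_x q x = 1).

Lemma iid_mass_ge0 a : 0 <= iid_mass a.
Proof. exact: prodr_ge0. Qed.

Lemma sum_indicator (v : T) : \sum_x q x * (x == v)%:R = q v.
Proof.
rewrite (bigD1 v) //= eqxx mulr1 big1 ?addr0 // => x /negbTE ->.
by rewrite mulr0.
Qed.

Lemma forall_indicator (B : {set I}) (v : T) (a : {ffun I -> T}) :
  [forall i in B, a i == v]%:R =
  \prod_i (if i \in B then (a i == v)%:R else 1) :> R.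
Proof.
rewrite -big_mkcond /=; have [/forall_inP aB|] := boolP [forall i in B, a i == v].
  by rewrite big1 // => i /aB ->.
rewrite negb_forall_in => /exists_inP[i iB /negbTE aiv].
by rewrite (bigD1 i) //= aiv mul0r.
Qed.

Lemma iid_forall (B : {set I}) (v : T) :
  \sum_a iid_mass a * [forall i in B, a i == v]%:R = q v ^+ #|B|.
Proof.
under eq_bigr do rewrite forall_indicator.
rewrite (iid_prod (fun i x => if i \in B then (x == v)%:R else 1)).
rewrite -prodr_const [RHS]big_mkcond /=.
apply: eq_bigr => i _; case: ifP => _; first exact: sum_indicator.
by under eq_bigr do rewrite mulr1.
Qed.

(** If [B] and [C] meet, a common ball would need two bins and the left side vanishes; if they are
    disjoint, independence gives equality. *)
Lemma iid_forall2_neq (B C : {set I}) (v w : T) : v != w ->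
  \sum_a iid_mass a * ([forall i in B, a i == v]%:R *
                       [forall i in C, a i == w]%:R)
  <= q v ^+ #|B| * q w ^+ #|C|.
Proof.
move=> vw; under eq_bigr do rewrite !forall_indicator -big_split.
rewrite (iid_prod (fun i x => (if i \in B then (x == v)%:R else 1) *
   (if i \in C then (x == w)%:R else 1))).
rewrite -!prodr_const [X in _ <= X * _]big_mkcond [X in _ <= _ * X]big_mkcond.
rewrite -big_split /=; apply: ler_prod => i _; apply/andP; split.
  by apply: sumr_ge0 => x _; do 2![case: ifP => _]; rewrite ?mulr_ge0.
case: ifP => _; case: ifP => _.
- rewrite big1 ?mulr_ge0 // => x _; have [->|] := eqVneq x v.
    by rewrite (negbTE vw) !mulr0.
  by rewrite mul0r mulr0.
- by under eq_bigr do rewrite mulr1; rewrite sum_indicator mulr1.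
- by under eq_bigr do rewrite mul1r; rewrite sum_indicator mul1r.
- by under eq_bigr do rewrite !mulr1; rewrite q_total mulr1.
Qed.

Lemma iid_forall2 (B C : {set I}) (v : T) :
  \sum_a iid_mass a * ([forall i in B, a i == v]%:R *
                       [forall i in C, a i == v]%:R)
  = q v ^+ #|B :|: C|.
Proof.
rewrite -iid_forall; apply: eq_bigr => a _; congr (_ * _).
rewrite -natrM mulnb; congr (nat_of_bool _)%:R.
apply/andP/forall_inP => [[/forall_inP aB /forall_inP aC] i|aBC].
  by rewrite finset.in_setU => /orP[/aB|/aC].
by split; apply/forall_inP => i iX; apply: aBC; rewrite finset.in_setU iX ?orbT.
Qed.

Lemma iid_total : \sum_a iid_mass a = 1.
Proof.
have /= := iid_prod (fun _ _ => 1); under eq_bigr do rewrite big1_eq mulr1.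
move=> ->; rewrite big1 // => i _.
by under eq_bigr do rewrite mulr1.
Qed.

Definition hits (a : {ffun I -> T}) (v : T) : nat := #|[set i | a i == v]|.

(** Chernoff's bound with parameter 1: Markov's inequality for [expR (hits a v)%:R], whose mean is
    the [#|I|]-th power of [1 + (expR 1 - 1) * q v]. *)
Lemma iid_upper_tail (v : T) (t : R) :
  \sum_(a | t < (hits a v)%:R) iid_mass a
  <= expR ((expR 1 - 1) * (#|I|%:R * q v)) * expR (- t).
Proof.
apply: (@le_trans _ _ (\sum_a iid_mass a * expR (hits a v)%:R * expR (- t))).
  rewrite [leRHS](bigID (fun a => t < (hits a v)%:R)) /= -[leLHS]addr0.
  apply: lerD; last first.
    apply: sumr_ge0 => a _.
    by rewrite !mulr_ge0 ?iid_mass_ge0 ?expR_ge0.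
  apply: ler_sum => a ta; rewrite -mulrA ler_peMr ?iid_mass_ge0 //.
  by rewrite -expRD -[leLHS]expR0 ler_expR subr_ge0 ltW.
rewrite -mulr_suml ler_wpM2r ?expR_ge0 //.
have expE a : expR (hits a v)%:R =
    \prod_i (if a i == v then expR 1 else 1) :> R.
  rewrite -big_mkcond prodr_const -expRM_natl mulr1 /hits.
  by congr (expR _%:R); apply: eq_card => i; rewrite !inE.
under eq_bigr do rewrite expE.
rewrite (iid_prod (fun _ x => if x == v then expR 1 else 1)) prodr_const.
have -> : \sum_x q x * (if x == v then expR 1 else 1) = 1 + (expR 1 - 1) * q v.
  rewrite -[X in X + _]q_total -(sum_indicator v) mulr_sumr -big_split /=.
  by apply: eq_bigr => x _; case: ifP => _; rewrite ?mulr1n ?mulr0n; ring.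
rewrite [(expR 1 - 1) * (_ * _)]mulrCA expRM_natl lerXn2r ?nnegrE ?expR_ge0 //.
  rewrite addr_ge0 // mulr_ge0 // subr_ge0 -expR0 ler_expR //.
exact: expR_ge1Dx.
Qed.

End Iid.

(** The curve [x ^+ k] lies above its tangent at 1; this is the convexity used to bound the mean
    count from below. *)
Lemma bernoulli_le (R : realFieldType) (x : R) (k : nat) :
  0 <= x -> 1 + k%:R * (x - 1) <= x ^+ k.
Proof.
move=> x0; elim: k => [|k IH]; first by rewrite mul0r addr0 expr0.
rewrite exprS; apply: le_trans (ler_wpM2l x0 IH).
rewrite -natr1; have : 0 <= k%:R * (x - 1) ^+ 2 by rewrite mulr_ge0 ?sqr_ge0.
nra.
Qed.

(** * Second moment method for the maximum occupancy *)

Section Occupancy.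
Variables (R : realType) (I T : finType) (q : T -> R) (S : {set T}).
Variables (k g : nat) (e : 'I_k * 'I_g -> I).
Hypotheses (e_inj : injective e) (q_ge0 : forall x, 0 <= q x).
Hypotheses (q_total : \sum_x q x = 1) (qS_total : \sum_(x in S) q x = 1).
Hypothesis gq_le1 : forall v, v \in S -> g%:R * q v <= 1.
Hypothesis g_gt0 : (0 < g)%N.

Let balls (phi : {ffun 'I_k -> 'I_g}) : {set I} := [set e (j, phi j) | j in 'I_k].

Let card_balls phi : #|balls phi| = k.
Proof.
rewrite /balls card_imset ?card_ord // => i j /e_inj.
by case.
Qed.

(** Injectivity of [e] keeps the blocks disjoint, so [psi] adds one new ball for each block where it
    differs from [phi]. *)
Let card_balls2 phi psi :
  #|balls phi :|: balls psi| = (k + #|[set j | phi j != psi j]|)%N.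
Proof.
set D := [set j | _].
have -> : balls phi :|: balls psi =
    balls phi :|: [set e (j, psi j) | j in D].
  apply/setP => i; rewrite !finset.in_setU.
  case: (boolP (i \in balls phi)) => //= iphi.
  apply/imsetP/imsetP => -[j jD ij]; exists j => //.
  rewrite inE; apply: contra iphi => /eqP phij.
  by apply/imsetP; exists j; rewrite // phij.
rewrite cardsU card_balls card_imset => [|i j /e_inj []//].
suff -> : balls phi :&: [set e (j, psi j) | j in D] = finset.set0.
  by rewrite cards0 subn0.
apply/setP => i; rewrite finset.in_setI finset.in_set0; apply/negP => /andP[].
case/imsetP => j _ -> /imsetP[l lD /e_inj[jl phil]].
by move: lD; rewrite inE -jl phil jl eqxx.
Qed.

(* [X] counts the pairs [(v, phi)] such that ball [phi j] of block [j] falls in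
   bin [v] for every [j]. Pairs with distinct bins are negatively correlated, so
   only the diagonal terms contribute to the variance. *)
Let hit (a : {ffun I -> T}) v phi := [forall i in balls phi, a i == v].
Let X (a : {ffun I -> T}) : R := \sum_(v in S) \sum_phi (hit a v phi)%:R.
Let mu : R := \sum_(v in S) (g%:R * q v) ^+ k.

Let mean_X : \sum_a iid_mass q a * X a = mu.
Proof.
under eq_bigr do rewrite mulr_sumr.
rewrite exchange_big /=; apply: eq_bigr => v vS.
under eq_bigr do rewrite mulr_sumr.
rewrite exchange_big /=.
under eq_bigr do rewrite (iid_forall q_total) card_balls.
by rewrite sumr_const card_ffun !card_ord -[LHS]mulr_natl natrX exprMn.
Qed.

(** The sum over [psi] factors over the blocks. In each block the choice agreeing with [phi]
    contributes 1 and the others together at most [g%:R * q v <= 1], hence a factor 2. *)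
Let diag_X v phi : v \in S ->
  \sum_psi q v ^+ #|balls phi :|: balls psi| <= q v ^+ k * 2 ^+ k.
Proof.
move=> vS; under eq_bigr do rewrite card_balls2 exprD.
rewrite -mulr_sumr ler_wpM2l ?exprn_ge0 //.
have -> : \sum_(psi : {ffun 'I_k -> 'I_g}) q v ^+ #|[set j | phi j != psi j]| =
    \prod_(j < k) \sum_(x < g) (if phi j != x then q v else 1).
  rewrite (bigA_distr_bigA (fun j x => if phi j != x then q v else 1)).
  apply: eq_bigr => psi _; rewrite -big_mkcond prodr_const.
  by congr (_ ^+ _); apply: eq_card => j; rewrite !inE.
rewrite -[k in 2 ^+ k]card_ord -prodr_const; apply: ler_prod => j _.
apply/andP; split; first by apply: sumr_ge0 => x _; case: ifP.
rewrite (bigD1 (phi j)) //= eqxx /= (_ : 2 = 1 + 1)//; apply: lerD => //.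
under eq_bigr => x xphi do rewrite eq_sym xphi.
rewrite sumr_const; apply: le_trans (gq_le1 vS).
rewrite -[leLHS]mulr_natl ler_wpM2r // ler_nat -[leqRHS]card_ord.
exact: max_card.
Qed.

Let second_X : \sum_a iid_mass q a * X a ^+ 2 <= mu ^+ 2 + 2 ^+ k * mu.
Proof.
have -> : \sum_a iid_mass q a * X a ^+ 2 =
   \sum_(v in S) \sum_(w in S) \sum_phi \sum_psi
     \sum_a iid_mass q a * ((hit a v phi)%:R * (hit a w psi)%:R).
  transitivity (\sum_a \sum_(v in S) \sum_(w in S) \sum_phi \sum_psi
     iid_mass q a * ((hit a v phi)%:R * (hit a w psi)%:R)).
    apply: eq_bigr => a _; rewrite expr2 big_distrlr /= mulr_sumr.
    apply: eq_bigr => v _; rewrite mulr_sumr; apply: eq_bigr => w _.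
    rewrite big_distrlr /= mulr_sumr.
    by apply: eq_bigr => phi _; rewrite mulr_sumr.
  rewrite exchange_big; apply: eq_bigr => v _.
  rewrite exchange_big; apply: eq_bigr => w _.
  rewrite exchange_big; apply: eq_bigr => phi _.
  by rewrite exchange_big.
(* The bound is expanded into the shape of the second moment, so that the two sides compare bin by
   bin. *)
have -> : mu ^+ 2 + 2 ^+ k * mu = \sum_(v in S)
    (\sum_(w in S) \sum_(phi : {ffun 'I_k -> 'I_g})
       \sum_(psi : {ffun 'I_k -> 'I_g}) q v ^+ k * q w ^+ k
     + \sum_(phi : {ffun 'I_k -> 'I_g}) q v ^+ k * 2 ^+ k).
  rewrite big_split expr2 big_distrlr /= mulr_sumr; congr (_ + _).
    apply: eq_bigr => v _; apply: eq_bigr => w _.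
    rewrite !exprMn -[g%:R ^+ k]natrX !sumr_const card_ffun !card_ord.
    by move: (g ^ k)%N => c; ring.
  apply: eq_bigr => v _.
  rewrite !exprMn -[g%:R ^+ k]natrX !sumr_const card_ffun !card_ord.
    by move: (g ^ k)%N => c; ring.
apply: ler_sum => v vS; rewrite (bigD1 v) //= [X in _ <= X + _](bigD1 v) //=.
rewrite addrC -[leRHS]addrA [X in _ <= X]addrC -addrA; apply: lerD.
  apply: ler_sum => w /andP[wS wv]; apply: ler_sum => phi _.
  apply: ler_sum => psi _; rewrite -{1}(card_balls phi) -(card_balls psi).
  by apply: iid_forall2_neq => //; rewrite eq_sym.
rewrite -[leLHS]addr0; apply: lerD.
  apply: ler_sum => phi _; apply: le_trans (diag_X phi vS).
  by apply: ler_sum => psi _; rewrite (iid_forall2 q_total).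
(* The diagonal terms of the expanded [mu ^+ 2] are nonnegative and are dropped. *)
by apply: sumr_ge0 => phi _; apply: sumr_ge0 => psi _; rewrite mulr_ge0 ?exprn_ge0.
Qed.

Let card_S_gt0 : (0 < #|S|)%N.
Proof.
rewrite lt0n cards_eq0; apply/eqP => S0; move: qS_total.
rewrite S0 big_set0 => /esym/eqP; by rewrite oner_eq0.
Qed.

(** The bins of [S] have total mass 1, so the values [#|S|%:R * q v] average to 1 and the linear
    terms of their tangent bounds cancel. *)
Let mu_ge : #|S|%:R * (g%:R / #|S|%:R) ^+ k <= mu.
Proof.
set N : R := #|S|%:R.
have N0 : 0 < N by rewrite ltr0n.
have -> : mu = (g%:R / N) ^+ k * \sum_(v in S) (N * q v) ^+ k.
  rewrite mulr_sumr; apply: eq_bigr => v _; rewrite -exprMn mulrA divfK //.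
  by rewrite gt_eqF.
rewrite mulrC ler_wpM2l ?exprn_ge0 ?divr_ge0 //.
apply: (@le_trans _ _ (\sum_(v in S) (1 + k%:R * (N * q v - 1)))).
  rewrite big_split /= sumr_const -mulr_sumr big_split /= -mulr_sumr qS_total.
  by rewrite sumrN sumr_const mulr1 subrr mulr0 addr0.
by apply: ler_sum => v _; apply: bernoulli_le; rewrite mulr_ge0 // ltW.
Qed.

(** Chebyshev's inequality: [X] vanishes when no bin of [S] receives [k] balls, so [mu ^+ 2] times
    this probability is at most the variance, itself at most [2 ^+ k * mu]. *)
Lemma iid_max_lower_tail :
  \sum_(a : {ffun I -> T} | [forall v in S, hits a v < k]%N) iid_mass q a
  <= (2 * #|S|%:R / g%:R) ^+ k / #|S|%:R.
Proof.
set N : R := #|S|%:R; set P := \sum_(a | _) _.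
have N0 : 0 < N by rewrite ltr0n.
have g0 : 0 < g%:R :> R by rewrite ltr0n.
have mu0 : 0 < mu.
  by apply: lt_le_trans mu_ge; rewrite mulr_gt0 ?exprn_gt0 ?divr_gt0.
have X0 a : [forall v in S, hits a v < k]%N -> X a = 0.
  move=> /forall_inP small; rewrite /X big1 // => v /small vk.
  rewrite big1 // => phi _; rewrite (_ : hit a v phi = false) //.
  apply/negP => /forall_inP hit_av; move: vk; rewrite ltnNge -(card_balls phi).
  move/negP; apply; apply: subset_leq_card.
  by apply/fintype.subsetP => i /hit_av; rewrite inE.
have var : mu ^+ 2 * P <= 2 ^+ k * mu.
  apply: (@le_trans _ _ (\sum_a iid_mass q a * (X a - mu) ^+ 2)).
    rewrite [leRHS](bigID (fun a => [forall v in S, hits a v < k]%N)) /=.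
    rewrite -[leLHS]addr0 mulr_sumr; apply: lerD.
      by apply: ler_sum => a /X0 ->; rewrite sub0r sqrrN mulrC.
    by apply: sumr_ge0 => a _; rewrite mulr_ge0 ?iid_mass_ge0 ?sqr_ge0.
  have -> : \sum_a iid_mass q a * (X a - mu) ^+ 2 =
      \sum_a iid_mass q a * X a ^+ 2 - mu ^+ 2.
    have expand (f : {ffun I -> T} -> R) (c : R) :
        \sum_a iid_mass q a * (f a - c) ^+ 2 =
        \sum_a iid_mass q a * f a ^+ 2 - 2 * c * (\sum_a iid_mass q a * f a)
        + c ^+ 2 * \sum_(a : {ffun I -> T}) iid_mass q a.
      rewrite !mulr_sumr -sumrN -!big_split /=.
      by apply: eq_bigr => a _; ring.
    rewrite expand mean_X (iid_total I q_total); ring.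
  by rewrite lerBlDl second_X.
have {var} var : mu * P <= 2 ^+ k.
  by rewrite -(ler_pM2l mu0) mulrA -expr2 (le_trans var) // mulrC.
have P0 : 0 <= P by apply: sumr_ge0 => a _; apply: iid_mass_ge0.
rewrite ler_pdivlMr // -mulrA exprMn -ler_pdivrMr; last first.
  by rewrite exprn_gt0 ?divr_gt0.
apply: le_trans var; rewrite [leRHS]mulrC.
rewrite -exprVn invf_div -mulrA ler_wpM2l //.
Qed.

End Occupancy.

(** * Balls of the torus *)

Section GraphDist.
Variables (T : finType) (e : rel T).

Lemma graph_dist_le (x y : T) (p : seq T) :
  path e x p -> last x p = y -> (graph_dist e x y <= size p)%N.
Proof.
move=> ep lp; rewrite /graph_dist; set P := fun k => _.
(* The search never returns more than [#|T|], which settles long paths. *)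
have [sp|sp] := ltnP (size p) #|T|; last first.
  by apply: leq_trans sp; rewrite -[leqRHS](size_iota 0) find_size.
rewrite leqNgt; apply/negP => /(before_find 0%N).
rewrite nth_iota // add0n => /negbT/negP; apply.
by apply/existsP; exists (in_tuple p); rewrite /= ep lp eqxx.
Qed.

(** The hypothesis excludes [#|T|], the default value for unreachable vertices. *)
Lemma graph_dist_path (x y : T) : (graph_dist e x y < #|T|)%N ->
  exists p : seq T, [/\ path e x p, last x p = y & size p = graph_dist e x y].
Proof.
rewrite /graph_dist; set P := fun k => _ => lt_d.
have : has P (iota 0 #|T|) by rewrite has_find size_iota.
move=> /(nth_find 0%N); rewrite nth_iota // add0n.
case/existsP => p /andP[ep /eqP lp]; exists p; split => //.
by rewrite size_tuple.
Qed.

End GraphDist.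

Section Torus.
Variable m : nat.
Local Notation dist := (graph_dist (@torus_adj m)).
Local Notation succ := (@ordS m).

Lemma val_iter_ordS (a : 'I_m) i : iter i succ a = ((a + i) %% m)%N :> nat.
Proof.
elim: i => [|i IH]; first by rewrite addn0 modn_small.
by rewrite iterS /= IH -addn1 modnDml addn1 addnS.
Qed.

Lemma iter_ordS_inj (a : 'I_m) i j : (i < m)%N -> (j < m)%N ->
  iter i succ a = iter j succ a -> i = j.
Proof.
move=> im jm /(congr1 val) /=; rewrite !val_iter_ordS => /eqP.
by rewrite eqn_modDl !modn_small // => /eqP.
Qed.

Lemma iter_cancel (T : Type) (f f' : T -> T) i :
  cancel f f' -> cancel (iter i f) (iter i f').
Proof.
by move=> fK; elim: i => [//|i IH] x; rewrite iterSr iterS fK.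
Qed.

(** Take [i] forward steps along the first coordinate, then [j] along the second. *)
Lemma torus_walk (a b : 'I_m) i j :
  (dist (a, b) (iter i succ a, iter j succ b) <= i + j)%N.
Proof.
pose p := traject (fun u : server m => (ordS u.1, u.2)) (succ a, b) i.
pose p' := traject (fun u : server m => (u.1, succ u.2)) (iter i succ a, succ b) j.
have iter1 k : iter k (fun u : server m => (ordS u.1, u.2)) (a, b) =
    (iter k succ a, b) by elim: k => //= k ->.
have iter2 c k : iter k (fun u : server m => (u.1, succ u.2)) (c, b) =
    (c, iter k succ b) by elim: k => //= k ->.
have lastp : last (a, b) p = (iter i succ a, b).
  by rewrite -iter1 -(last_traject (fun u : server m => (ordS u.1, u.2))).
have -> : (i + j = size (p ++ p'))%N by rewrite size_cat !size_traject.
apply: graph_dist_le; last first.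
  rewrite last_cat lastp -iter2.
  by rewrite -(last_traject (fun u : server m => (u.1, succ u.2))).
rewrite cat_path lastp; apply/andP; split.
  apply: sub_path (fpath_traject (fun u : server m => (ordS u.1, u.2)) (a, b) i).
  by move=> u _ /eqP <-; rewrite /torus_adj /cycle_adj /= !eqxx orbT.
apply: sub_path
  (fpath_traject (fun u : server m => (u.1, succ u.2)) (iter i succ a, b) j).
by move=> u _ /eqP <-; rewrite /torus_adj /cycle_adj /= !eqxx.
Qed.

(** The ball contains a square of side [h.+1] with corner [u], and [h < m] keeps the square from
    wrapping onto itself. *)
Lemma card_ball_ge (u : server m) (h : nat) : (h < m)%N ->
  (h.+1 ^ 2 <= #|[set w | dist u w <= 2 * h]|)%N.
Proof.
case: u => a b hm.
pose F (x : 'I_h.+1 * 'I_h.+1) : server m := (iter x.1 succ a, iter x.2 succ b).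
have F_inj : injective F.
  move=> [i j] [i' j'] [] /= ii jj; congr (_, _); apply/val_inj => /=.
    by apply: iter_ordS_inj ii; apply: leq_trans hm.
  by apply: iter_ordS_inj jj; apply: leq_trans hm.
have -> : (h.+1 ^ 2 = #|F @: [set: 'I_h.+1 * 'I_h.+1]|)%N.
  by rewrite card_imset // cardsT card_prod card_ord mulnn.
apply: subset_leq_card; apply/fintype.subsetP => _ /imsetP[[i j] _ ->].
rewrite inE; apply: leq_trans (torus_walk _ _ _ _) _.
by rewrite mul2n -addnn leq_add // -ltnS.
Qed.

(** Positions are recorded without subtraction: adding one forward step per move turns a backward
    move, a stay and a forward move into 0, 1 and 2 forward steps. *)
Lemma cycle_adj_iter (a b c : 'I_m) (k i : nat) : (a == b) || cycle_adj a b ->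
  iter k succ c = iter i succ b -> (i <= 2 * k)%N ->
  exists2 i', (i' <= 2 * k.+1)%N & iter k.+1 succ c = iter i' succ a.
Proof.
move=> adj kc ik; rewrite iterS kc.
case/or3P: adj => [/eqP->|/eqP->|/eqP->].
- by exists i.+1; rewrite ?iterS //; lia.
- exists i.+2; first lia.
  by rewrite -iterSr -iterS.
- exists i; first lia.
  by rewrite -iterSr.
Qed.

Lemma path_torus_iter (u : server m) (p : seq (server m)) :
  path (@torus_adj m) u p -> exists i j,
  [/\ (i <= 2 * size p)%N, (j <= 2 * size p)%N,
    iter (size p) succ (last u p).1 = iter i succ u.1 &
    iter (size p) succ (last u p).2 = iter j succ u.2].
Proof.
elim: p u => [|w p IH] u /=; first by exists 0%N, 0%N.
case/andP => adj /IH[i [j [ik jk ei ej]]].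
have [|i' ik' ei'] := cycle_adj_iter (a := u.1) _ ei ik.
  by case/orP: adj => /andP[]; [move=> -> | move=> ->; rewrite orbT].
have [|j' jk' ej'] := cycle_adj_iter (a := u.2) _ ej jk.
  by case/orP: adj => /andP[]; [move=> _ ->; rewrite orbT | move=> _ ->].
by exists i', j'.
Qed.

Lemma card_ball_le (v : server m) (r : nat) : (r < #|server m|)%N ->
  (#|[set u | dist u v <= r]| <= (2 * r).+1 ^ 2)%N.
Proof.
move=> rm.
(* From the point [r] steps forward of [v] on each coordinate, every point of the ball is reached by
   between 0 and [2 * r] backward steps per coordinate. *)
pose F (x : 'I_(2 * r).+1 * 'I_(2 * r).+1) : server m :=
  (iter x.1 (@ord_pred m) (iter r succ v.1),
   iter x.2 (@ord_pred m) (iter r succ v.2)).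
apply: leq_trans (_ : #|F @: [set: 'I_(2 * r).+1 * 'I_(2 * r).+1]| <= _)%N.
  apply: subset_leq_card; apply/fintype.subsetP => u; rewrite inE => duv.
  have [|p [ep lp sp]] := graph_dist_path (e := @torus_adj m) (x := u) (y := v).
    exact: leq_ltn_trans rm.
  have [i [j [ik jk]]] := path_torus_iter ep; rewrite lp sp => ei ej.
  set k := dist u v in duv sp ei ej.
  have shift (x y : 'I_m) l : iter k succ x = iter l succ y ->
      iter (r - k + l) (@ord_pred m) (iter r succ x) = y.
    move=> e; have -> : iter r succ x = iter (r - k) succ (iter k succ x).
      by rewrite -iterD subnK.
    rewrite e -iterD.
    exact: (iter_cancel _ (@ordSK m)).
  have ir : (r - k + i < (2 * r).+1)%N by lia.
  have jr : (r - k + j < (2 * r).+1)%N by lia.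
  apply/imsetP; exists (Ordinal ir, Ordinal jr) => //.
  by rewrite /F /= (shift _ _ _ ei) (shift _ _ _ ej); case: (u).
apply: leq_trans (leq_imset_card _ _) _.
by rewrite cardsT card_prod card_ord mulnn.
Qed.

End Torus.

(** * Law of the assignment *)

Section NearestReplica.
Variables (R : realType) (m K M : nat) (p : 'I_K -> R).
Hypotheses (p_ge0 : forall f, 0 <= p f) (p_total : \sum_f p f = 1).
Local Notation dist := (graph_dist (@torus_adj m)).

(** The servers of [B] have [M * #|B|] independent slots, each missing [f] with probability
    [1 - p f]. *)
Lemma placement_avoid (B : {set server m}) (f : 'I_K) :
  \sum_(Z : placement m K M | [forall v in B, v \notin replicas Z f])
     placement_mass p Z = (1 - p f) ^+ (M * #|B|).
Proof.
pose h (v : server m) (c : {ffun 'I_M -> 'I_K}) : R :=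
  if v \in B then \prod_s (c s != f)%:R else 1.
(* A placement is an iid family of servers, each of them an iid family of slots. *)
transitivity (\sum_Z iid_mass (iid_mass p) Z * \prod_v h v (Z v)).
  rewrite big_mkcond; apply: eq_bigr => Z _.
  have -> : \prod_v h v (Z v) = [forall v in B, v \notin replicas Z f]%:R.
    rewrite -big_mkcond /=.
    have [/forall_inP avoid|] := boolP [forall v in B, v \notin replicas Z f].
      rewrite big1 // => v /avoid; rewrite inE negb_exists => /forallP Zf.
      by rewrite big1 // => s _; rewrite Zf.
    rewrite negb_forall_in => /exists_inP[v vB]; rewrite negbK inE.
    case/existsP => s Zvs.
    by rewrite (bigD1 v) //= (bigD1 s) //= Zvs /= !mul0r.
  by case: ifP => _; rewrite ?mulr1 ?mulr0.
rewrite (iid_prod _ h) exprM -prodr_const [RHS]big_mkcond /=.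
apply: eq_bigr => v _; rewrite /h; case: ifP => _; last first.
  by under eq_bigr do rewrite mulr1; apply: iid_total.
rewrite (iid_prod _ (fun _ x => (x != f)%:R)) prodr_const card_ord.
congr (_ ^+ _); rewrite -[X in X - _]p_total (bigD1 f) //= eqxx mulr0 add0r.
rewrite [in RHS](bigD1 f) //= addrAC subrr add0r.
by apply: eq_bigr => x ->; rewrite mulr1.
Qed.

Definition covers (Z : placement m K M) (r : nat) : bool :=
  [forall u, forall f, exists w, (w \in replicas Z f) && (dist u w <= r)%N].

Lemma placement_mass_ge0 (Z : placement m K M) : 0 <= placement_mass p Z.
Proof. by apply: prodr_ge0 => v _; apply: prodr_ge0. Qed.

(** Union bound over the origin and the file, with [card_ball_ge] counting the slots in a ball. *)
Lemma placement_not_covers_le (h : nat) : (h < m)%N ->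
  \sum_(Z | ~~ covers Z (2 * h)) placement_mass p Z
  <= #|server m|%:R * \sum_f (1 - p f) ^+ (M * h.+1 ^ 2).
Proof.
move=> hm.
pose ball u : {set server m} := [set w | dist u w <= 2 * h]%N.
pose avoid (Z : placement m K M) u f := [forall v in ball u, v \notin replicas Z f].
apply: (@le_trans _ _ (\sum_u \sum_f \sum_(Z | avoid Z u f) placement_mass p Z)).
  rewrite [leRHS](eq_bigr (fun u => \sum_Z \sum_f
    (if avoid Z u f then placement_mass p Z else 0))) => [|u _]; last first.
    by rewrite exchange_big; apply: eq_bigr => f _; rewrite big_mkcond.
  rewrite exchange_big [leLHS]big_mkcond /=; apply: ler_sum => Z _.
  case: ifP => [|_]; last first.
    apply: sumr_ge0 => u _; apply: sumr_ge0 => f _.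
    by case: ifP => // _; apply: placement_mass_ge0.
  rewrite negb_forall => /existsP[u]; rewrite negb_forall => /existsP[f].
  rewrite negb_exists => /forallP none.
  have avo : avoid Z u f.
    apply/forall_inP => w; rewrite inE => duw.
    by apply: contra (none w) => ->; rewrite duw.
  have term_ge0 u' f' : 0 <= if avoid Z u' f' then placement_mass p Z else 0.
    by case: ifP => // _; apply: placement_mass_ge0.
  apply: (@le_trans _ _ (\sum_f' (if avoid Z u f' then placement_mass p Z else 0))).
    rewrite [leRHS](bigD1 f) // avo lerDl.
    by apply: sumr_ge0 => f' _; apply: term_ge0.
  rewrite [leRHS](bigD1 u) // lerDl.
  by apply: sumr_ge0 => u' _; apply: sumr_ge0 => f' _; apply: term_ge0.
rewrite mulr_natl -sumr_const; apply: ler_sum => u _; apply: ler_sum => f _.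
rewrite placement_avoid; apply: ler_wiXn2l.
- rewrite subr_ge0 -[leRHS]p_total (bigD1 f) //= lerDl; exact: sumr_ge0.
- by rewrite gerBl.
by rewrite leq_mul2l card_ball_ge ?orbT.
Qed.

(** Law of the server of a single request for a fixed placement, with origin, file and tie-break
    averaged out. *)
Definition nearest_law (Z : placement m K M) (o : option (server m)) : R :=
  \sum_(x : server m * 'I_K)
    (#|server m|%:R^-1 * p x.2) * tie_mass R (nearest_replicas Z x.1 x.2) o.

Lemma tie_mass_ge0 (T : finType) (S : {set T}) o : 0 <= tie_mass R S o.
Proof. by case: o => [v|]; rewrite /tie_mass ?divr_ge0. Qed.

Lemma nearest_law_ge0 Z o : 0 <= nearest_law Z o.
Proof.
by apply: sumr_ge0 => x _; rewrite !mulr_ge0 ?invr_ge0 ?tie_mass_ge0.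
Qed.

Lemma nearest_law_total Z : (0 < m)%N -> \sum_o nearest_law Z o = 1.
Proof.
move=> m0; rewrite exchange_big /=.
under eq_bigr do rewrite -mulr_sumr tie_mass_total mulr1.
rewrite -(pair_bigA _ (fun (_ : server m) f => #|server m|%:R^-1 * p f)) /=.
rewrite -mulr_sumr p_total mulr1 sumr_const -[LHS]mulr_natr mulVf //.
by rewrite pnatr_eq0 card_prod card_ord muln_eq0 orbb -lt0n.
Qed.

(** Given [Z], both the request mass and the tie-breaking mass are products over the requests, so
    summing out the requests leaves an iid law. *)
Lemma Pr_assignment (N : nat) (E : pred (assignment m N)) :
  Pr p (fun w : outcome m K M N => E w.2) =
  \sum_Z placement_mass p Z * \sum_(A | E A) iid_mass (nearest_law Z) A.
Proof.
rewrite /Pr big_mkcond.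
rewrite (eq_bigr (fun w : outcome m K M N =>
  if E w.2 then placement_mass p w.1.1 * requests_mass p w.1.2 *
    nearest_mass R w.1.1 w.1.2 w.2 else 0)); last by case=> -[].
rewrite -(pair_bigA _ (fun (x : placement m K M * requests m K N) A =>
  if E A then placement_mass p x.1 * requests_mass p x.2 *
    nearest_mass R x.1 x.2 A else 0)) /=.
rewrite -(pair_bigA _ (fun (Z : placement m K M) (Q : requests m K N) =>
  \sum_A (if E A then placement_mass p Z * requests_mass p Q *
    nearest_mass R Z Q A else 0))) /=.
apply: eq_bigr => Z _; rewrite exchange_big mulr_sumr [RHS]big_mkcond /=.
apply: eq_bigr => A _; case: (E A); last by rewrite big1.
under eq_bigr do rewrite -mulrA.
rewrite -mulr_sumr; congr (_ * _).
rewrite /iid_mass /nearest_law (bigA_distr_bigA (fun i (x : server m * 'I_K) =>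
  (#|server m|%:R^-1 * p x.2) * tie_mass R (nearest_replicas Z x.1 x.2) (A i))).
by apply: eq_bigr => Q _; rewrite [RHS]big_split.
Qed.

Section Covers.
Variables (Z : placement m K M) (r : nat).
Hypothesis Zr : covers Z r.

Lemma nearest_law_None : nearest_law Z None = 0.
Proof.
apply: big1 => -[u f] _ /=; rewrite (_ : (_ == _) = false) ?mulr0 //.
have /existsP[w0 /andP[w0Z _]] := forallP (forallP Zr u) f.
case: (arg_minnP (fun w => dist u w) w0Z) => v vZ vmin.
have vN : v \in nearest_replicas Z u f.
  rewrite inE (vZ : v \in replicas Z f) /=.
  by apply/forall_inP => w wZ; apply: vmin.
by apply/negP => /eqP near0; rewrite near0 finset.in_set0 in vN.
Qed.

Lemma nearest_replicas_dist u f v : v \in nearest_replicas Z u f ->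
  (v \in replicas Z f) && (dist u v <= r)%N.
Proof.
rewrite inE => /andP[vZ /forall_inP vmin]; rewrite vZ /=.
have /existsP[w /andP[wZ wr]] := forallP (forallP Zr u) f.
exact: leq_trans (vmin _ wZ) wr.
Qed.

End Covers.
End NearestReplica.

(* A request reaches [v] only if its file is one of the at most [M] files
   cached at [v] and its origin lies in the ball of radius [r] around [v]. *)
Lemma nearest_law_uniform_le (R : realType) (m K M r : nat)
    (Z : placement m K M) (v : server m) :
  covers Z r -> (r < #|server m|)%N ->
  nearest_law (@uniform_popularity R K) Z (Some v)
  <= (M * (2 * r).+1 ^ 2)%:R / (#|server m|%:R * K%:R).
Proof.
move=> Zr rm; rewrite /nearest_law /uniform_popularity.
rewrite -mulr_sumr -invfM mulrC ler_wpM2r ?invr_ge0 ?mulr_ge0 //.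
pose F := [set u | graph_dist (@torus_adj m) u v <= r]%N.
pose C := [set Z v s | s : 'I_M].
apply: (@le_trans _ _ (#|finset.setX F C|%:R)); last first.
  rewrite ler_nat cardsX mulnC leq_mul ?card_ball_le //.
  by apply: leq_trans (leq_imset_card _ _) _; rewrite card_ord.
rewrite -sum1_card natr_sum big_mkcond [leRHS]big_mkcond /=.
apply: ler_sum => -[u f] _ /=; rewrite finset.in_setX.
have [vuf|_] := boolP (v \in nearest_replicas Z u f); last first.
  by rewrite mul0r; case: ifP.
have /andP[vZ duv] := nearest_replicas_dist Zr vuf.
have -> : (u \in F) && (f \in C).
  rewrite inE duv /=; move: vZ; rewrite inE => /existsP[s /eqP <-].
  by apply/imsetP; exists s.
rewrite mul1r invf_le1 ?ler1n ?ltr0n; last by apply/card_gt0P; exists v.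
by apply/card_gt0P; exists v.
Qed.

(** * Load tails *)

(** Raise [expR y >= 1 + y >= y] to a power. This makes powers of [n] dominate powers of [ln n]. *)
Lemma expR_ge_pow (R : realType) (k : nat) (x : R) : 0 <= x ->
  (x / k.+1%:R) ^+ k.+1 <= expR x.
Proof.
move=> x0; have -> : x = k.+1%:R * (x / k.+1%:R).
  by rewrite mulrC divfK // pnatr_eq0.
rewrite expRM_natl [k.+1%:R * _]mulrC !mulfK ?pnatr_eq0 //.
have y0 : 0 <= x / k.+1%:R by rewrite divr_ge0.
rewrite lerXn2r ?nnegrE ?expR_ge0 //.
by apply: le_trans (expR_ge1Dx _); rewrite lerDr.
Qed.

Lemma exists_inj_ord (T : finType) (n : nat) : (#|T| <= n)%N ->
  exists e : T -> 'I_n, injective e.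
Proof.
move=> Tn; exists (fun x => widen_ord Tn (enum_rank x)) => x y.
by move=> /(congr1 val) /= /val_inj /enum_rank_inj.
Qed.

Lemma mem_imset_Some (T : finType) (x : option T) :
  (x \in [set Some v | v : T]) = (x != None).
Proof.
by case: x => [v|]; apply/imsetP => //=; [exists v | case].
Qed.

(** Chernoff's bound gives each server a tail of [expR (- (2 * L))]; the union over [n], that is
    [expR L], servers leaves [expR (- L)]. *)
Lemma max_load_upper_tail (R : realType) (m n : nat) (L : R)
    (q : option (server m) -> R) :
  #|server m| = n -> expR L = n%:R -> 
  (forall o, 0 <= q o) -> \sum_o q o = 1 ->
  (forall v, q (Some v) <= 75 * L / n%:R) ->
  \sum_(A : assignment m n | ((expR 1 - 1) * 75 + 2) * L < (max_load A)%:R)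
    iid_mass q A <= expR (- L).
Proof.
move=> n_server expL q_ge0 q_total q_le; set b := (_ + 2).
have n_gt0 : 0 < n%:R :> R by rewrite -expL expR_gt0.
apply: (@le_trans _ _ (\sum_(v : server m)
   \sum_(A : assignment m n | b * L < (hits A (Some v))%:R) iid_mass q A)).
  rewrite [leRHS](eq_bigr (fun v => \sum_(A : assignment m n)
     (if b * L < (hits A (Some v))%:R then iid_mass q A else 0))); last first.
    by move=> v _; rewrite big_mkcond.
  rewrite exchange_big [leLHS]big_mkcond /=; apply: ler_sum => A _.
  have term_ge0 v : 0 <= if b * L < (hits A (Some v))%:R
      then iid_mass q A else 0 by case: ifP => // _; apply: iid_mass_ge0.
  case: ifP => [bL|_]; last exact: sumr_ge0.
  have card0 : (0 < #|server m|)%N by rewrite n_server -(ltr0n R).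
  have [v maxv] := bigop.eq_bigmax (fun v : server m => load A v) card0.
  move: bL; rewrite /max_load maxv => bL.
  by rewrite (bigD1 v) //= bL lerDl; apply: sumr_ge0.
apply: (@le_trans _ _ (\sum_(v : server m)
    expR ((expR 1 - 1) * 75 * L) * expR (- (b * L)))).
  apply: ler_sum => v _; apply: le_trans (iid_upper_tail _ _ _ _ _) _ => //.
  rewrite ler_wpM2r ?expR_ge0 // ler_expR card_ord -mulrA ler_wpM2l //.
  rewrite -ler_pdivlMl // mulrC; exact: q_le.
rewrite sumr_const n_server -[leLHS]mulr_natl -expL -!expRD ler_expR /b.
by rewrite le_eqVlt; apply/orP; left; apply/eqP; ring.
Qed.

Lemma max_load_lower_tail (R : realType) (m n : nat) (L : R)
    (q : option (server m) -> R) :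
  #|server m| = n -> expR L = n%:R -> 1000 <= L ->
  (forall o, 0 <= q o) -> \sum_o q o = 1 -> q None = 0 ->
  (forall v, q (Some v) <= 75 * L / n%:R) ->
  \sum_(A : assignment m n | (max_load A)%:R < 12^-1 * (L / ln L))
    iid_mass q A <= expR (- (2^-1 * L)).
Proof.
move=> n_server expL L_large q_ge0 q_total q_None q_le.
have n_gt0 : 0 < n%:R :> R by rewrite -expL expR_gt0.
have L0 : 0 < L by lra.
(* From [(L / 24) ^+ 2 <= expR (L / 12)], whose left side is at least [L] once [L >= 576]. *)
have lnL : ln L <= L / 12.
  rewrite -ler_expR lnK //.
  apply: le_trans (expR_ge_pow 1 _); last lra.
  rewrite expr2; nra.
have lnL1 : 1 <= ln L.
  have half : expR (2^-1 : R) <= 2.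
    have := expR_ge1Dx (- (2^-1) : R); rewrite expRN => inv_ge.
    have e0 := expR_gt0 (2^-1 : R).
    rewrite -lef_pV2 ?posrE //; lra.
  rewrite -ler_expR lnK // (_ : 1 = 2%:R * 2^-1); last lra.
  rewrite expRM_natl; apply: (@le_trans _ _ (2 ^+ 2)); last by rewrite expr2; lra.
  by rewrite lerXn2r ?nnegrE ?expR_ge0.
set y := 12^-1 * (L / ln L).
have y0 : 0 <= y by rewrite mulr_ge0 ?divr_ge0 //; lra.
have yL : y <= L.
  rewrite /y mulrA ler_pdivrMr; last lra.
  nra.
(* The successor makes [k] exceed [y], so a maximum load below [y] puts every load below [k]. *)
pose k := (Num.trunc y).+1.
have yk : y < k%:R by apply: truncnS_gt.
have ky : k%:R <= y + 1 by rewrite -natr1 lerD2r truncn_le.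
have z2 : 2 <= n%:R / L ^+ 2.
  rewrite ler_pdivlMr ?exprn_gt0 // -expL.
  apply: le_trans (expR_ge_pow 2 _); last lra.
  rewrite !exprS expr0 /=; nra.
pose g := Num.trunc (n%:R / L ^+ 2).
have gz : g%:R <= n%:R / L ^+ 2 by rewrite truncn_le; lra.
have zg : n%:R / L ^+ 2 < g%:R + 1 by rewrite natr1; apply: truncnS_gt.
have g0 : 0 < g%:R :> R by lra.
(* The blocks fit because [k <= y + 1 <= L ^+ 2] and [g] is at most [n / L ^+ 2]. *)
have [e e_inj] : exists e : 'I_k * 'I_g -> 'I_n, injective e.
  apply: exists_inj_ord; rewrite card_prod !card_ord -(ler_nat R) natrM.
  apply: (@le_trans _ _ (L ^+ 2 * (n%:R / L ^+ 2))).
    rewrite ler_pM //; nra.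
  by rewrite mulrC divfK // gt_eqF ?exprn_gt0.
pose S := [set Some v | v : server m].
have cardS : #|S| = n by rewrite card_imset // => x y' [].
have qS_total : \sum_(x in S) q x = 1.
  rewrite -q_total [RHS](bigD1 None) //= q_None add0r.
  by apply: eq_bigl => x; rewrite mem_imset_Some.
have gq v : v \in S -> g%:R * q v <= 1.
  case/imsetP => w _ ->.
  apply: (@le_trans _ _ (n%:R / L ^+ 2 * (75 * L / n%:R))).
    by rewrite ler_pM.
  have -> : n%:R / L ^+ 2 * (75 * L / n%:R) = 75 / L.
    by field; rewrite !gt_eqF.
  rewrite ler_pdivrMr //; lra.
apply: (@le_trans _ _ (\sum_(A : assignment m n | [forall v in S, hits A v < k]%N)
    iid_mass q A)).
  rewrite [leLHS]big_mkcond [leRHS]big_mkcond; apply: ler_sum => A _.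
  case: ifP => [Ay|_]; last by case: ifP => // _; apply: iid_mass_ge0.
  suff -> : [forall v in S, hits A v < k]%N by [].
  apply/forall_inP => _ /imsetP[v _ ->]; rewrite -(ltr_nat R).
  apply: le_lt_trans yk; apply: le_trans (ltW Ay); rewrite ler_nat.
  exact: (bigop.leq_bigmax (F := fun v => load A v)).
have g_nat : (0 < g)%N by rewrite -(ltr0n R).
apply: le_trans (iid_max_lower_tail e_inj q_ge0 q_total qS_total gq g_nat) _.
rewrite cardS ler_pdivrMr // -[X in _ <= _ * X]expL -expRD.
have L_ge0 := ltW L0.
(* Truncation at most halves [n / L ^+ 2], so [2 * n / g <= 4 * L ^+ 2 <= L ^+ 3]. *)
apply: (@le_trans _ _ ((L ^+ 3) ^+ k)).
  rewrite lerXn2r ?nnegrE ?divr_ge0 ?mulr_ge0 ?exprn_ge0 //.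
  rewrite ler_pdivrMr //.
  have nE : n%:R = n%:R / L ^+ 2 * L ^+ 2 :> R.
    by rewrite divfK // gt_eqF // exprn_gt0.
  have : n%:R <= 2 * g%:R * L ^+ 2 :> R.
    rewrite [leLHS]nE ler_wpM2r ?exprn_ge0 ?ltW //; lra.
  rewrite !exprS expr0; nra.
rewrite -exprM (_ : L ^+ (3 * k) = expR ((3 * k)%:R * ln L)); last first.
  by rewrite expRM_natl lnK.
rewrite ler_expR natrM.
have lnL0 : ln L != 0 by rewrite gt_eqF // (lt_le_trans _ lnL1).
(* With [k <= y + 1], [3 * k * ln L] is at most [L / 4 + L / 4]: the factor [12^-1] in [y] gives one
   quarter, [lnL] the other. *)
have yE : y * ln L = L / 12 by rewrite /y mulrA divfK // mulrC.
nra.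
Qed.

(** * Averaging over placements and choice of constants *)

(** Placements outside [G] are charged their whole mass; on [G] the conditional failure probability
    is at most [delta]. *)
Lemma Pr_assignment_ge (R : realType) (m K M N : nat) (p : 'I_K -> R)
    (E : pred (assignment m N)) (G : pred (placement m K M)) (beta delta : R) :
  (0 < m)%N -> (forall f, 0 <= p f) -> \sum_f p f = 1 -> 0 <= delta ->
  \sum_(Z | ~~ G Z) placement_mass p Z <= beta ->
  (forall Z, G Z -> \sum_(A | ~~ E A) iid_mass (nearest_law p Z) A <= delta) ->
  1 - beta - delta <= Pr p (fun w : outcome m K M N => E w.2).
Proof.
move=> m0 p0 p1 d0 Gbeta Edelta; rewrite (@Pr_assignment R m K M p N E).
have mass1 : \sum_(Z : placement m K M) placement_mass p Z = 1.
  exact: (iid_total _ (iid_total _ p1)).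
apply: (@le_trans _ _ (\sum_Z (placement_mass p Z * (1 - delta)
   - (if ~~ G Z then placement_mass p Z else 0)))).
  rewrite big_split /= -mulr_suml mass1 mul1r sumrN -big_mkcond /=; lra.
apply: ler_sum => Z _; have Z0 := placement_mass_ge0 p0 Z.
have law0 := nearest_law_ge0 p0 Z.
case: ifP => [_|/negbFE GZ]; last first.
  rewrite subr0 ler_wpM2l //.
  have := iid_total 'I_N (nearest_law_total p1 Z m0).
  rewrite (bigID E) /= => total; have := Edelta _ GZ; lra.
have : 0 <= \sum_(A | E A) iid_mass (nearest_law p Z) A.
  by apply: sumr_ge0 => A _; apply: iid_mass_ge0.
move=> S0; apply: (@le_trans _ _ 0); last exact: mulr_ge0.
nra.
Qed.

(* The ball of radius [2 * h] contains a square of side [h.+1], in which at least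
   [3 ln n] replicas of a given file are expected. *)
Lemma covering_radius (R : realType) (m n M : nat) (L : R) :
  n = (m ^ 2)%N -> expR L = n%:R -> 1000 <= L ->
  3 * L < M%:R -> M%:R <= n%:R :> R ->
  exists h : nat, [/\ (h < m)%N,
    3 * L * n%:R <= (M * h.+1 ^ 2)%:R &
    (M * (2 * (2 * h)).+1 ^ 2)%:R / (n%:R * n%:R) <= 75 * L / n%:R].
Proof.
move=> nm expL L_large ML Mn.
have n0 : 0 < n%:R :> R by rewrite -expL expR_gt0.
have M0 : 0 < M%:R :> R by lra.
(* The number of servers whose slots hold [3 * L] expected replicas of a file; [h] is the integer
   part of its square root. *)
pose X := 3 * L * n%:R / M%:R.
have XM : X * M%:R = 3 * L * n%:R by rewrite /X divfK // gt_eqF.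
have X0 : 0 <= X by rewrite /X divr_ge0 // ?mulr_ge0 //; lra.
have X1 : 1 <= X by rewrite ler_pdivlMr //; nra.
have Xn : X < n%:R by rewrite ltr_pdivrMr //; nra.
have sX := sqr_sqrtr X0; set s := Num.sqrt X in sX.
have s0 : 0 <= s by apply: sqrtr_ge0.
have s1 : 1 <= s by rewrite expr2 in sX; nra.
pose h := Num.trunc s; exists h.
have hs : h%:R <= s by rewrite truncn_le.
have sh : s < h.+1%:R by apply: truncnS_gt.
have h1 : 1 <= h%:R :> R by rewrite ler1n truncn_gt0.
split.
- rewrite -(ltr_nat R) -(@ltr_pXn2r _ 2) ?nnegrE // -[ltRHS]natrX -nm.
  by apply: le_lt_trans Xn; rewrite -sX lerXn2r ?nnegrE.
- rewrite natrM natrX -XM mulrC ler_wpM2l // -sX.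
  by rewrite lerXn2r ?nnegrE // ltW.
rewrite ler_pdivrMr ?mulr_gt0 // mulrA divfK ?gt_eqF // natrM natrX.
rewrite -natr1 !natrM.
(* Since [s >= 1], [4 * h + 1 <= 5 * s]; the square gives [25 * X], and [M * X = 3 * L * n] yields
   the constant 75. *)
apply: (@le_trans _ _ (M%:R * (25 * X))); last first.
  by rewrite mulrCA [M%:R * X]mulrC XM; lra.
rewrite ler_wpM2l // -sX !expr2; nra.
Qed.

Theorem theorem2 (R : realType) (alpha : R) (M : nat -> nat)
    (halpha : 0 < alpha < 2^-1)
    (hM : forall n : nat, `|(M n)%:R - n%:R `^ alpha| < 1) :
  exists c a b : R, [/\ 0 < c, 0 < a, 0 < b &
    exists n0 : nat, forall m n : nat, n = (m ^ 2)%N -> (n0 <= n)%N ->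
      1 - 1 / n%:R `^ c <=
      Pr (@uniform_popularity R n)
        (fun w : outcome m n (M n) n =>
           (a * (ln n%:R / ln (ln n%:R)) <= (max_load w.2)%:R) &&
           ((max_load w.2)%:R <= b * ln n%:R))].
Proof.
have /andP[a0 a2] := halpha.
pose b : R := (expR 1 - 1) * 75 + 2.
exists 4^-1, 12^-1, b; split; rewrite ?invr_gt0 //.
  have := expR_ge1Dx (1 : R); rewrite /b; lra.
(* The second term makes [n `^ alpha] exceed [4 * ln n]. *)
pose L0 : R := 1000 + 16 / alpha ^+ 2.
exists (Num.trunc (expR L0)).+1 => m n nm n_large.
have n0 : 0 < n%:R :> R by rewrite ltr0n; apply: leq_trans n_large.
have expL : expR (ln n%:R) = n%:R :> R by rewrite lnK.
have L_ge : L0 <= ln n%:R.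
  rewrite -ler_expR expL ltW //; apply: lt_le_trans (truncnS_gt _) _.
  by rewrite ler_nat.
have powE c : n%:R `^ c = expR (c * ln n%:R) :> R.
  by rewrite /powR gt_eqF.
move: (hM n); rewrite !powE; set L := ln n%:R in expL L_ge *.
have alpha2 : 0 < alpha ^+ 2 by rewrite exprn_gt0.
have q0 : 0 <= 16 / alpha ^+ 2 by rewrite divr_ge0 // ltW.
have L_large : 1000 <= L by rewrite /L0 in L_ge; lra.
have alphaL : 16 <= alpha ^+ 2 * L.
  by rewrite -ler_pdivrMl // mulrC; rewrite /L0 in L_ge; lra.
rewrite ltr_norml => /andP[M_gt M_lt].
have ML : 3 * L < (M n)%:R.
  have pow2 : (alpha * L / 2) ^+ 2 <= expR (alpha * L).
    by apply: (expR_ge_pow 1); nra.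
  have : 4 * L <= (alpha * L / 2) ^+ 2.
    by rewrite (_ : _ ^+ 2 = alpha ^+ 2 * L * L / 4); [nra | field].
  lra.
(* Here [alpha < 2^-1] enters: [M n] is below the square root of [n] plus 1. *)
have Mn : (M n)%:R <= n%:R :> R.
  have half : expR (alpha * L) <= expR (2^-1 * L) by rewrite ler_expR; nra.
  have half_ge : 2 <= expR (2^-1 * L).
    by apply: le_trans (expR_ge1Dx _); lra.
  have halfE : n%:R = expR (2^-1 * L) * expR (2^-1 * L) :> R.
    by rewrite -expRD -expL; congr expR; field.
  nra.
have [h [hm h_ge h_le]] := covering_radius nm expL L_large ML Mn.
have m1 : (1 < m)%N.
  rewrite ltnNge; apply/negP => m1.
  have : n%:R <= 1 :> R by rewrite (ler_nat R _ 1) nm -(exp1n 2) leq_exp2r.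
  by rewrite -expL; have := expR_ge1Dx L; lra.
have m0 := ltnW m1.
have card_server : #|server m| = n by rewrite card_prod card_ord nm mulnn.
have hr : (2 * h < #|server m|)%N.
  rewrite card_server nm -mulnn; apply: (@leq_trans (2 * m)).
    by rewrite ltn_mul2l.
  by rewrite leq_mul2r m1 orbT.
have p0 (f : 'I_n) : 0 <= uniform_popularity R f by rewrite invr_ge0.
have p1 : \sum_(f < n) uniform_popularity R f = 1.
  by rewrite sumr_const card_ord -[LHS]mulr_natl divff // gt_eqF.
pose E (A : assignment m n) :=
  (12^-1 * (L / ln L) <= (max_load A)%:R) && ((max_load A)%:R <= b * L).
(* The three errors add up to at most [3 * expR (- (2^-1 * L))]; the factor 3 is absorbed by halving
   the exponent, hence [4^-1]. *)
apply: le_trans (_ : 1 - expR (- L) - (expR (- L) + expR (- (2^-1 * L))) <= _).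
  have h4 : expR (- L) <= expR (- (2^-1 * L)) by rewrite ler_expR; lra.
  have h3 : 3 <= expR (4^-1 * L) by apply: le_trans (expR_ge1Dx _); lra.
  have sq : expR (- (2^-1 * L)) = expR (- (4^-1 * L)) * expR (- (4^-1 * L)).
    by rewrite -expRD; congr expR; field.
  rewrite div1r -expRN.
  have pos := expR_gt0 (- (4^-1 * L)).
  have one : expR (4^-1 * L) * expR (- (4^-1 * L)) = 1 by rewrite -expRD subrr expR0.
  nra.
apply: (Pr_assignment_ge (E := E) (G := fun Z => covers Z (2 * h)) m0 p0 p1).
- by rewrite addr_ge0 ?expR_ge0.
- apply: le_trans (placement_not_covers_le _ p0 p1 hm) _.
  (* By [1 - x <= expR (- x)] and the [3 * L] expected replicas; of the exponent 3, the sums over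
     origins and files use up 2. *)
  apply: (@le_trans _ _ (n%:R * (n%:R * expR (- (3 * L))))).
    rewrite card_server ler_wpM2l // mulr_natl -[n in _ *+ n]card_ord.
    rewrite -sumr_const; apply: ler_sum => f _.
    apply: (@le_trans _ _ (expR (- n%:R^-1) ^+ (M n * h.+1 ^ 2))).
      have n1 : n%:R^-1 <= 1 :> R by rewrite invf_le1 // ler1n -(ltr0n R).
      rewrite lerXn2r ?nnegrE ?expR_ge0 //; last exact: expR_ge1Dx.
      by rewrite /uniform_popularity subr_ge0.
    rewrite -expRM_natl ler_expR mulrN lerN2 ler_pdivlMr //.
  rewrite -expL -!expRD ler_expR; lra.
move=> Z ZG; set q := nearest_law _ Z.
have q_ge0 := nearest_law_ge0 p0 Z.
have q_total := nearest_law_total p1 Z m0.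
have q_le v : q (Some v) <= 75 * L / n%:R.
  apply: le_trans (nearest_law_uniform_le _ _ ZG hr) _.
  by rewrite card_server.
have q_None : q None = 0 by apply: nearest_law_None ZG.
apply: le_trans (lerD (max_load_upper_tail card_server expL q_ge0 q_total q_le)
  (max_load_lower_tail card_server expL L_large q_ge0 q_total q_None q_le)).
(* Union bound: a failure of [E] is a load too large or too small. *)
rewrite [leLHS]big_mkcond [X in _ <= X + _]big_mkcond [X in _ <= _ + X]big_mkcond.
rewrite -big_split; apply: ler_sum => A _ /=.
have A0 := iid_mass_ge0 q_ge0 A.
rewrite /E negb_and -!ltNge orbC.
by case: ifP => [/orP[->|->]|_]; do ?case: ifP => _;
  rewrite ?addr0 ?add0r ?lerDl ?lerDr ?addr_ge0.
Qed.
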